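(* Consider the client-side game with client set $\mathcal{N}=\{1,\dots,N\}$, strategy sets $[0,1]$ and utilities $U_i(x_i;\boldsymbol{x}_{-i},p_i) = -\hat\lambda_q\|\mu(\boldsymbol{x})-\mu_i\|_{\mathcal{H}}^2 + p_i x_i - c_i x_i$. In any Nash equilibrium $\boldsymbol{x}^*$, for each client $k\in\mathcal{N}$ with payment rate $p_k$, the equilibrium strategy $x_k^*$ is $$x_k^*(p_k) = \begin{cases} 0 & \text{if } p_k < \underline{p_k},\\ \left( \dfrac{\phi(\boldsymbol{x}^*_{-k})}{\alpha_k^2 (c_k-p_k)} \right)^{1/3} - \dfrac{S_0}{\alpha_k} & \text{if } \underline{p_k} \leq p_k \leq \overline{p_k},\\ 1 & \text{if } p_k > \overline{p_k},\end{cases}$$ where $S_0=\sum_{i\ne k}\alpha_i x_i^*$, $\phi(\boldsymbol{x}^*_{-k}) = 2\hat\lambda_q\left\|\sum_{i\neq k}\alpha_i x_i^*(\mu_i-\mu_k)\right\|_{\mathcal{H}}^2$, and the threshold payments are $$\underline{p_k} = c_k-\frac{\alpha_k\phi(\boldsymbol{x}_{-k}^* )}{S_0^3},\qquad \overline{p_k}=c_k-\frac{\alpha_k\phi(\boldsymbol{x}_{-k}^* )}{(S_0+\alpha_k)^3}.$$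
   Context: $\mathcal{N}=\{1,\dots,N\}$ is the set of clients. Client $i$ has weight $\alpha_i=n_i/\sum_{j\in\mathcal{N}}n_j>0$ ($n_i$ its number of data points), so $\sum_i\alpha_i=1$; a kernel mean embedding $\mu_i\in\mathcal{H}$, with $\mathcal{H}$ a reproducing kernel Hilbert space; a unit participation cost $c_i>0$; and a payment rate $p_i\ge 0$. The constant $\hat\lambda_q>0$ is fixed. For a participation profile $\boldsymbol{x}=(x_1,\dots,x_N)\in[0,1]^N$ the aggregated embedding is $$\mu(\boldsymbol{x})=\frac{\sum_{i\in\mathcal{N}}\alpha_i x_i\mu_i}{\sum_{i\in\mathcal{N}}\alpha_i x_i}$$ (the formula is meaningful when $\sum_i\alpha_ix_i>0$; no separate convention is fixed at $\boldsymbol{x}=0$). $\boldsymbol{x}_{-i}$ denotes the strategies of all clients other than $i$. A profile $\boldsymbol{x}^*\in[0,1]^N$ is a Nash equilibrium if for every $i\in\mathcal{N}$, $U_i(x_i^*;\boldsymbol{x}_{-i}^*,p_i)\ge U_i(x_i;\boldsymbol{x}_{-i}^*,p_i)$ for all $x_i\in[0,1]$.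
   Formalization: The middle case is asserted only for p_k ≠ c_k: if φ = 0 both thresholds equal c_k and at p_k = c_k the formula is 0/0 (any x_k can be a best response when S_0 > 0); when S_0 = 0 the quotient 0/0 in the lower threshold is read as 0. *)

(* Defs.v *)
From HB Require Import structures.
From mathcomp Require Import all_boot all_order all_algebra.
From mathcomp Require Import all_classical all_reals all_analysis.

Set Implicit Arguments.
Unset Strict Implicit.
Unset Printing Implicit Defensive.

Import Order.TTheory GRing.Theory Num.Theory.
Import numFieldNormedType.Exports.

Local Open Scope ring_scope.

(* A real reproducing kernel Hilbert space of functions X -> R.  Elements are
   identified with functions through the injective map [rkhs_eval]; its
   linearity follows from [rkhs_reproducing].  The reproducing kernel is
   k(x, y) = rkhs_eval (rkhs_feature y) x. *)
Record rkhs (R : realType) (X : Type) := RKHS {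
  rkhs_space :> completeNormedModType R;
  rkhs_dot : {dot rkhs_space for idfun};
  rkhs_normE : forall f : rkhs_space, `|f| ^+ 2 = rkhs_dot f f;
  rkhs_eval : rkhs_space -> X -> R;
  rkhs_eval_inj : injective rkhs_eval;
  rkhs_feature : X -> rkhs_space;
  rkhs_reproducing :
    forall (f : rkhs_space) (x : X), rkhs_eval f x = rkhs_dot f (rkhs_feature x)
}.

(* The kernel mean embedding of P is the m in H with <f, m> = E_P[f] for all
   f in H. *)
Definition mean_embedding (R : realType) (d : measure_display)
    (X : measurableType d) (H : rkhs R X) (P : probability X R) (m : H) : Prop :=
  forall f : H,
    P.-integrable setT (fun x => (rkhs_eval f x)%:E) /\
    (rkhs_dot H f m)%:E = (\int[P]_x (rkhs_eval f x)%:E)%E.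

Definition weight (R : realType) (N : nat) (n : 'I_N -> nat) (i : 'I_N) : R :=
  (n i)%:R / \sum_(j < N) (n j)%:R.

Definition strategy_profile (R : realType) (N : nat) (x : 'I_N -> R) : Prop :=
  forall i, 0 <= x i <= 1.

(* The quotient is meaningless when the denominator vanishes; [mu0] is the
   value taken there, which is left as a parameter. *)
Definition aggregate (R : realType) (H : normedModType R) (N : nat)
    (alpha : 'I_N -> R) (mu : 'I_N -> H) (mu0 : H) (x : 'I_N -> R) : H :=
  let s := \sum_(i < N) alpha i * x i in
  if s == 0 then mu0 else s^-1 *: \sum_(i < N) (alpha i * x i) *: mu i.

(* Payoff of client [i] when it plays [t] and the others play according to
   [x]; the value [x i] is irrelevant. *)
Definition utility (R : realType) (H : normedModType R) (N : nat) (lambda : R)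
    (alpha : 'I_N -> R) (mu : 'I_N -> H) (mu0 : H) (c p : 'I_N -> R)
    (i : 'I_N) (t : R) (x : 'I_N -> R) : R :=
  - lambda * `|aggregate alpha mu mu0 [eta x with i |-> t] - mu i| ^+ 2
  + p i * t - c i * t.

Definition nash_equilibrium (R : realType) (N : nat)
    (U : 'I_N -> R -> ('I_N -> R) -> R) (x : 'I_N -> R) : Prop :=
  strategy_profile x /\
  forall (i : 'I_N) (t : R), 0 <= t <= 1 -> U i (x i) x >= U i t x.

Definition others_mass (R : realType) (N : nat) (alpha x : 'I_N -> R)
    (k : 'I_N) : R :=
  \sum_(i < N | i != k) alpha i * x i.

Definition phi (R : realType) (H : normedModType R) (N : nat) (lambda : R)
    (alpha : 'I_N -> R) (mu : 'I_N -> H) (x : 'I_N -> R) (k : 'I_N) : R :=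
  2 * lambda * `|\sum_(i < N | i != k) (alpha i * x i) *: (mu i - mu k)| ^+ 2.

(* When [others_mass] is 0 so is [phi], and the quotient 0 / 0 is read as 0. *)
Definition lower_payment (R : realType) (H : normedModType R) (N : nat)
    (lambda : R) (alpha : 'I_N -> R) (mu : 'I_N -> H) (c x : 'I_N -> R)
    (k : 'I_N) : R :=
  c k - alpha k * phi lambda alpha mu x k / others_mass alpha x k ^+ 3.

Definition upper_payment (R : realType) (H : normedModType R) (N : nat)
    (lambda : R) (alpha : 'I_N -> R) (mu : 'I_N -> H) (c x : 'I_N -> R)
    (k : 'I_N) : R :=
  c k - alpha k * phi lambda alpha mu x k
        / (others_mass alpha x k + alpha k) ^+ 3.

(* Main.v *)
(* Put [S = S0 + alpha_k t] and [V = sum_(i != k) alpha_i x_i (mu_i - mu_k)].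
   The aggregate minus [mu_k] is [V / S], so up to a constant the payoff of [k]
   is [- A / S^2 - q S] with [A = lambda |V|^2 = phi / 2] and
   [q = (c_k - p_k) / alpha_k].  Comparing the payoffs at [y] and [z] amounts
   to the sign of [(y - z) (A (y + z) - q y^2 z^2)], so that no derivative is
   needed: the equilibrium value [y] is compared with one [z], namely an end
   of the interval [[S0, S0 + alpha_k]] or the critical point given by
   [q z^3 = 2 A].  When [S0 = 0] we have [phi = 0], and the payoff is linear
   except for a possible jump at [t = 0]. *)
Require Import Defs.
From mathcomp Require Import all_boot all_order all_algebra.
From mathcomp Require Import all_classical all_reals all_analysis.
From mathcomp Require Import ring lra.
Import Order.TTheory GRing.Theory Num.Theory.
Import numFieldNormedType.Exports.
Local Open Scope ring_scope.

(** * Minimizing the cost [A / s^2 + q s] over [s > 0] *)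

Section InverseSquarePayoff.
Set Implicit Arguments.
Unset Strict Implicit.
Context {R : realFieldType}.
Implicit Types A q y z : R.

Lemma inverse_square_payoff_le A q y z : 0 < y -> 0 < z ->
  A / y ^+ 2 + q * y <= A / z ^+ 2 + q * z ->
  0 <= (y - z) * (A * (y + z) - q * y ^+ 2 * z ^+ 2).
Proof.
move=> y0 z0; rewrite -subr_ge0 => le_yz.
have -> : (y - z) * (A * (y + z) - q * y ^+ 2 * z ^+ 2) =
    (A / z ^+ 2 + q * z - (A / y ^+ 2 + q * y)) * (y ^+ 2 * z ^+ 2).
  by field; rewrite !gt_eqF.
by rewrite mulr_ge0// mulr_ge0// sqr_ge0.
Qed.

(** The cost is convex for [A >= 0], and its derivative at [z] has the sign of [q z^3 - 2 A]. Here
    it is already increasing at [z], so every point further right costs strictly more. *)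
Lemma inverse_square_payoff_left A q y z : 0 <= A -> 0 < z -> z <= y ->
  2 * A < q * z ^+ 3 ->
  A / y ^+ 2 + q * y <= A / z ^+ 2 + q * z -> y = z.
Proof.
move=> A0 z0 zy Aq le_yz.
have y0 : 0 < y := lt_le_trans z0 zy.
have := inverse_square_payoff_le y0 z0 le_yz.
apply: contraTeq => yz; rewrite -ltNge.
have {}zy : 0 < y - z by rewrite subr_gt0 lt_neqAle eq_sym yz.
rewrite pmulr_rlt0// -(pmulr_llt0 _ z0).
(* The extra factor [z] brings out the sign of the derivative at [z]; the remainder is a convexity
   term of known sign. *)
have -> : (A * (y + z) - q * y ^+ 2 * z ^+ 2) * z =
  (2 * A - q * z ^+ 3) * y ^+ 2 - A * ((y - z) * (2 * y + z)) by ring.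
have : (2 * A - q * z ^+ 3) * y ^+ 2 < 0.
  by rewrite pmulr_llt0 ?exprn_gt0// subr_lt0.
have : 0 <= A * ((y - z) * (2 * y + z)) by rewrite mulr_ge0// mulr_ge0; lra.
lra.
Qed.

Lemma inverse_square_payoff_right A q y z : 0 <= A -> 0 < y -> y <= z ->
  q * z ^+ 3 < 2 * A ->
  A / y ^+ 2 + q * y <= A / z ^+ 2 + q * z -> y = z.
Proof.
move=> A0 y0 yz Aq le_yz.
have z0 : 0 < z := lt_le_trans y0 yz.
have := inverse_square_payoff_le y0 z0 le_yz.
apply: contraTeq => y_neq_z; rewrite -ltNge.
have {}yz : y - z < 0 by rewrite subr_lt0 lt_neqAle y_neq_z.
rewrite nmulr_rlt0// -(pmulr_lgt0 _ z0).
have -> : (A * (y + z) - q * y ^+ 2 * z ^+ 2) * z =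
  (2 * A - q * z ^+ 3) * y ^+ 2 + A * ((z - y) * (2 * y + z)) by ring.
have : 0 < (2 * A - q * z ^+ 3) * y ^+ 2.
  by rewrite pmulr_lgt0 ?exprn_gt0// subr_gt0.
have : 0 <= A * ((z - y) * (2 * y + z)) by rewrite mulr_ge0// mulr_ge0; lra.
lra.
Qed.

(** For [A > 0] the cost is strictly convex, so its stationary point is its only minimizer. *)
Lemma inverse_square_payoff_critical A q y z : 0 < A -> 0 < y -> 0 < z ->
  q * z ^+ 3 = 2 * A ->
  A / y ^+ 2 + q * y <= A / z ^+ 2 + q * z -> y = z.
Proof.
move=> A0 y0 z0 Aq le_yz.
have := inverse_square_payoff_le y0 z0 le_yz.
apply: contraTeq => y_neq_z; rewrite -ltNge -(pmulr_llt0 _ z0).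
have -> : (y - z) * (A * (y + z) - q * y ^+ 2 * z ^+ 2) * z =
  (2 * A - q * z ^+ 3) * (y ^+ 2 * (y - z))
  - A * ((y - z) ^+ 2 * (2 * y + z)) by ring.
rewrite Aq subrr mul0r sub0r oppr_lt0 mulr_gt0// mulr_gt0//; last lra.
by rewrite exprn_even_gt0//= subr_eq0.
Qed.

End InverseSquarePayoff.

Lemma weight_gt0 (R : realType) (N : nat) (n : 'I_N -> nat) (i : 'I_N) :
  (forall j, (0 < n j)%N) -> 0 < @weight R N n i.
Proof.
move=> n0; rewrite /weight divr_gt0 ?ltr0n// (bigD1 i)//=.
by rewrite ltr_pwDl ?ltr0n// sumr_ge0.
Qed.

(** * The payoff of client [k] and its best response *)

Section ClientGame.
Set Implicit Arguments.
Unset Strict Implicit.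
Context {R : realType} {H : normedModType R} {N : nat}.
Variables (lambda : R) (alpha : 'I_N -> R) (mu : 'I_N -> H) (mu0 : H).
Variables (c p x : 'I_N -> R) (k : 'I_N).

Local Notation S0 := (others_mass alpha x k).
Local Notation phik := (phi lambda alpha mu x k).
Local Notation U := (utility lambda alpha mu mu0 c p).

Lemma aggregate_subr (t : R) : S0 + alpha k * t != 0 ->
  aggregate alpha mu mu0 [eta x with k |-> t] - mu k =
  (S0 + alpha k * t)^-1 *:
    \sum_(i < N | i != k) (alpha i * x i) *: (mu i - mu k).
Proof.
move=> S_neq0; rewrite /aggregate.
have -> : \sum_(i < N) alpha i * [eta x with k |-> t] i = S0 + alpha k * t.
  rewrite (bigD1 k)//= eqxx addrC; congr (_ + _).
  by apply: eq_bigr => i /negbTE /= ->.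
rewrite (negbTE S_neq0).
(* With [mu k] spread over the total mass, the contribution of client [k] itself cancels. *)
rewrite -[X in _ - X](scalerK S_neq0) -scalerBr; congr (_ *: _).
rewrite (bigD1 k)//= eqxx scalerDl [X in X - _]addrC [X in _ - X]addrC addrKA.
rewrite scaler_suml -sumrN -big_split/=; apply: eq_bigr => i /negbTE ->.
by rewrite scalerBr addrC.
Qed.

Lemma utilityE (t : R) : S0 + alpha k * t != 0 ->
  U k t x = - (phik / 2 / (S0 + alpha k * t) ^+ 2) - (c k - p k) * t.
Proof.
move=> S_neq0; rewrite /utility aggregate_subr// normrZ exprMn.
rewrite real_normK ?num_real// /phi exprVn.
by field.
Qed.

Hypothesis alpha_gt0 : forall i, 0 < alpha i.
Hypothesis lambda_gt0 : 0 < lambda.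
Hypothesis x_nash : nash_equilibrium U x.

Let xk01 : 0 <= x k <= 1. Proof. by case: x_nash. Qed.

Lemma phi_ge0 : 0 <= phik.
Proof. by rewrite /phi mulr_ge0 ?sqr_ge0// mulr_ge0// ltW. Qed.

Lemma mass_ge0 i : 0 <= alpha i * x i.
Proof.
by rewrite mulr_ge0 ?(ltW (alpha_gt0 i))//; case: x_nash => /(_ i)/andP[].
Qed.

Lemma others_mass_ge0 : 0 <= S0.
Proof. by apply: sumr_ge0 => i _; exact: mass_ge0. Qed.

Lemma phi_eq0 : S0 = 0 -> phik = 0.
Proof.
move=> /eqP; rewrite psumr_eq0; last by move=> i _; exact: mass_ge0.
move=> /allP x0; rewrite /phi big1 ?normr0 ?expr0n ?mulr0// => i ik.
by have /implyP/(_ ik)/eqP-> := x0 i (mem_index_enum i); rewrite scale0r.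
Qed.

(** The equilibrium condition with the total mass as variable: [t] in [[0, 1]] corresponds to
    [z = S0 + alpha k * t], and the payoff becomes a cost up to sign and a constant. *)
Lemma nash_payoff_le (z : R) : 0 < S0 -> S0 <= z <= S0 + alpha k ->
  phik / 2 / (S0 + alpha k * x k) ^+ 2
    + (c k - p k) / alpha k * (S0 + alpha k * x k) <=
  phik / 2 / z ^+ 2 + (c k - p k) / alpha k * z.
Proof.
move=> S0_gt0 /andP[Sz zS]; set y := S0 + _; set q := _ / alpha k.
have ak := alpha_gt0 k.
pose t := (z - S0) / alpha k.
have zE : z = S0 + alpha k * t by rewrite /t mulrC divfK ?gt_eqF// addrC subrK.
have t01 : 0 <= t <= 1.
  by rewrite /t divr_ge0 ?subr_ge0 ?(ltW ak)//= ler_pdivrMr// mul1r lerBlDl.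
have y0 : 0 < y by rewrite ltr_pwDl// mulr_ge0 ?(ltW ak)//; case/andP: xk01.
have z0 : 0 < z := lt_le_trans S0_gt0 Sz.
have [_ /(_ k t t01)] := x_nash.
rewrite !utilityE -?zE -/y ?gt_eqF//.
have qt s : q * (S0 + alpha k * s) = q * S0 + (c k - p k) * s.
  by rewrite /q; field; rewrite gt_eqF.
have := qt (x k); have := qt t; rewrite -zE -/y; lra.
Qed.

Lemma utility_alone (t : R) : S0 = 0 -> 0 < t -> U k t x = (p k - c k) * t.
Proof.
move=> S00 t0; rewrite utilityE; last by rewrite S00 add0r mulf_neq0 ?gt_eqF.
by rewrite (phi_eq0 S00) !mul0r; ring.
Qed.

Lemma nash_below_lower : p k < lower_payment lambda alpha mu c x k -> x k = 0.
Proof.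
rewrite /lower_payment; have ak := alpha_gt0 k; case/andP: xk01 => xk0 xk1.
have := others_mass_ge0; rewrite le_eqVlt => /orP[/eqP/esym S00|S0_gt0].
  rewrite (phi_eq0 S00) mulr0 mul0r subr0 => pc; apply/eqP.
  have {xk0} := xk0; rewrite le_eqVlt eq_sym => /orP[//|xk_gt0].
  (* A deviation to 0 would bring in [mu0]; halving stays where the payoff is linear. *)
  have h01 : 0 <= x k / 2 <= 1 by lra.
  have [_ /(_ k (x k / 2) h01)] := x_nash.
  rewrite !utility_alone//; last lra.
  have : 0 < (c k - p k) * x k by rewrite mulr_gt0// subr_gt0.
  lra.
move=> plo.
have : S0 + alpha k * x k = S0.
  apply: (@inverse_square_payoff_left _ (phik / 2) ((c k - p k) / alpha k)) => //.
  - by rewrite divr_ge0// phi_ge0.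
  - by rewrite lerDl mulr_ge0// ltW.
  - rewrite mulrCA divff// mulr1 mulrAC ltr_pdivlMr// mulrC.
    rewrite -ltr_pdivrMr ?exprn_gt0//; lra.
  - by apply: nash_payoff_le; rewrite // lexx lerDl ltW.
rewrite -[RHS]addr0 => /addrI/eqP; rewrite mulf_eq0 gt_eqF//=.
exact: eqP.
Qed.

Lemma nash_above_upper : p k > upper_payment lambda alpha mu c x k -> x k = 1.
Proof.
rewrite /upper_payment; have ak := alpha_gt0 k; case/andP: xk01 => xk0 xk1.
have := others_mass_ge0; rewrite le_eqVlt => /orP[/eqP/esym S00|S0_gt0].
  rewrite (phi_eq0 S00) mulr0 mul0r subr0 => pc; apply/eqP.
  rewrite eq_le xk1/= leNgt; apply/negP => xk_lt1.
  have h01 : 0 <= (1 : R) <= 1 by rewrite ler01 lexx.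
  have [_ /(_ k 1 h01)] := x_nash.
  rewrite (utility_alone S00 ltr01) mulr1.
  (* At 0 the payoff is at most 0 whatever [mu0] is, while playing 1 earns [p k - c k > 0]. *)
  have [->|xk_neq0] := eqVneq (x k) 0.
    rewrite /utility !mulr0 subr0 addr0 mulNr.
    set u := lambda * _; have : 0 <= u by rewrite mulr_ge0 ?sqr_ge0// ltW.
    lra.
  rewrite utility_alone ?lt_neqAle ?xk0 1?eq_sym ?xk_neq0//.
  have : 0 < (p k - c k) * (1 - x k) by rewrite mulr_gt0// subr_gt0.
  lra.
move=> pup.
have : S0 + alpha k * x k = S0 + alpha k.
  apply: (@inverse_square_payoff_right _ (phik / 2) ((c k - p k) / alpha k)) => //.
  - by rewrite divr_ge0// phi_ge0.
  - by rewrite ltr_pwDl// mulr_ge0// ltW.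
  - by rewrite lerD2l ger_pMr.
  - rewrite [X in _ < X]mulrCA divff// mulr1 mulrAC ltr_pdivrMr// [X in _ < X]mulrC.
    rewrite -ltr_pdivlMr ?exprn_gt0 ?addr_gt0//; lra.
  - by apply: nash_payoff_le; rewrite // lexx andbT lerDl ltW.
by move=> /addrI; rewrite -[RHS]mulr1 => /mulfI; apply; rewrite gt_eqF.
Qed.

Lemma nash_between :
  lower_payment lambda alpha mu c x k <= p k <= upper_payment lambda alpha mu c x k ->
  p k != c k ->
  x k = (phik / (alpha k ^+ 2 * (c k - p k))) `^ (3%:R^-1) - S0 / alpha k.
Proof.
rewrite /lower_payment /upper_payment => /andP[plo pup] pc.
have ak := alpha_gt0 k; case/andP: xk01 => xk0 xk1.
(* If [S0 = 0], both thresholds equal [c k], which forces the excluded [p k = c k]. *)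
have [S00|S0_neq0] := eqVneq S0 0.
  by move: plo pup pc; rewrite (phi_eq0 S00) !mulr0 !mul0r subr0; lra.
have S0_gt0 : 0 < S0 by rewrite lt_neqAle eq_sym S0_neq0 others_mass_ge0.
have Sa_gt0 : 0 < S0 + alpha k by rewrite addr_gt0.
have pc_gt0 : 0 < c k - p k.
  have : 0 <= alpha k * phik / (S0 + alpha k) ^+ 3.
    by rewrite divr_ge0 ?exprn_ge0 ?mulr_ge0 ?phi_ge0// ltW.
  by lra.
have le_lo : (c k - p k) * S0 ^+ 3 <= alpha k * phik.
  by rewrite -ler_pdivlMr ?exprn_gt0//; lra.
have le_up : alpha k * phik <= (c k - p k) * (S0 + alpha k) ^+ 3.
  by rewrite -ler_pdivrMr ?exprn_gt0//; lra.
have phik_gt0 : 0 < phik.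
  rewrite -(pmulr_rgt0 _ ak); apply: lt_le_trans le_lo.
  by rewrite mulr_gt0 ?exprn_gt0.
(* The critical mass is [alpha k] times the cube root of [w]. *)
set w := (X in X `^ _).
have w_gt0 : 0 < w by rewrite /w divr_gt0// mulr_gt0// exprn_gt0.
have w3 : (w `^ 3%:R^-1) ^+ 3 = w.
  by rewrite -powR_mulrn ?powR_ge0// -powRrM mulVf// powRr1// ltW.
have z_gt0 : 0 < alpha k * w `^ 3%:R^-1 by rewrite mulr_gt0// powR_gt0.
have z3 : (c k - p k) * (alpha k * w `^ 3%:R^-1) ^+ 3 = alpha k * phik.
  by rewrite exprMn w3 /w; field; rewrite !gt_eqF.
have : S0 + alpha k * x k = alpha k * w `^ 3%:R^-1.
  apply: (@inverse_square_payoff_critical _ (phik / 2) ((c k - p k) / alpha k)) => //.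
  - by rewrite divr_gt0.
  - by rewrite ltr_pwDl// mulr_ge0// ltW.
  - by rewrite mulrAC z3; field; rewrite gt_eqF.
  (* The critical mass is feasible: after cubing, its two bounds are the two threshold inequalities
     [le_lo] and [le_up]. *)
  - apply: nash_payoff_le => //; apply/andP; split.
      rewrite -(@ler_pXn2r _ 3)// ?nnegrE ?(ltW S0_gt0) ?(ltW z_gt0)//.
      by rewrite -(ler_pM2l pc_gt0) z3.
    rewrite -(@ler_pXn2r _ 3)// ?nnegrE ?(ltW Sa_gt0) ?(ltW z_gt0)//.
    by rewrite -(ler_pM2l pc_gt0) z3.
move=> yz; apply: (mulfI (lt0r_neq0 ak)).
rewrite mulrBr -yz mulrCA divff ?gt_eqF// mulr1; ring.
Qed.

End ClientGame.

(* The side condition [p k != c k] of the middle case excludes only phik = 0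
   (both thresholds then equal c k), where the formula reads 0 / 0 and the
   best response is not determined; phik > 0 forces p k < c k there. *)
Theorem theorem5p4 (R : realType) (d : measure_display) (X : measurableType d)
  (H : rkhs R X) (N : nat) (n : 'I_N -> nat) (P : 'I_N -> probability X R)
  (mu : 'I_N -> H) (mu0 : H) (c p : 'I_N -> R) (lambda : R)
  (xs : 'I_N -> R) (k : 'I_N) :
  (forall i, (0 < n i)%N) ->
  (forall i, mean_embedding (P i) (mu i)) ->
  (forall i, 0 < c i) ->
  (forall i, 0 <= p i) ->
  0 < lambda ->
  let alpha := @weight R N n in
  nash_equilibrium (utility lambda alpha mu mu0 c p) xs ->
  let S0 := others_mass alpha xs k in
  let phik := phi lambda alpha mu xs k in
  let plo := lower_payment lambda alpha mu c xs k in
  let pup := upper_payment lambda alpha mu c xs k in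
  [/\ p k < plo -> xs k = 0,
      plo <= p k <= pup -> p k != c k ->
        xs k = (phik / (alpha k ^+ 2 * (c k - p k))) `^ (3%:R^-1) - S0 / alpha k
    & p k > pup -> xs k = 1].
Proof.
move=> n_gt0 _ _ _ lambda_gt0 alpha xs_nash S0 phik plo pup.
have alpha_gt0 i : 0 < alpha i by exact: weight_gt0.
split.
- exact: nash_below_lower xs_nash.
- exact: nash_between xs_nash.
- exact: nash_above_upper xs_nash.
Qed.
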